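(* Let $A$ be an abelian group and let $\tau:\mathbb{Z}_3\to A$ be a function with $\tau(0)=0$. The Galkin quandle $G(A,\tau)$ is Latin if and only if $|A|$ is odd.
   Context: $\mathbb{Z}_n$ denotes the integers modulo $n$. A quandle is a non-empty set $X$ with a binary operation $*$ such that: (1) $a*a=a$ for all $a\in X$; (2) for all $b,c\in X$ there is a unique $a\in X$ with $a*b=c$; (3) $(a*b)*c=(a*c)*(b*c)$ for all $a,b,c\in X$. For an abelian group $A$ and a function $\tau:\mathbb{Z}_3\to A$ with $\tau(0)=0$, the Galkin quandle $G(A,\tau)$ is the set $\mathbb{Z}_3\times A$ with operation $(x,a)*(y,b)=(2y-x,\,-a+\mu(x-y)b+\tau(x-y))$, where $\mu:\mathbb{Z}_3\to\mathbb{Z}$ is given by $\mu(0)=2$, $\mu(1)=\mu(2)=-1$. A quandle $X$ is Latin if for each $a\in X$ the left translation $\mathcal{L}_a:X\to X$, $\mathcal{L}_a(x)=a*x$, is a bijection.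
   Formalization: The abelian group A is taken to be finite, as ''|A| is odd'' presupposes; for infinite A the equivalence fails, e.g. for A = Q with τ = 0 the Galkin quandle is Latin although |A| is not odd. *)

(* Defs.v *)
From HB Require Import structures.
From mathcomp Require Import all_boot all_order all_algebra.

Set Implicit Arguments.
Unset Strict Implicit.
Unset Printing Implicit Defensive.

Import GRing.Theory.
Local Open Scope ring_scope.

Record quandle := Quandle {
  quandle_sort :> Type;
  qop : quandle_sort -> quandle_sort -> quandle_sort;
  quandle_nonempty : inhabited quandle_sort;
  qop_idem : forall a, qop a a = a;
  qop_rdiv : forall b c, exists! a, qop a b = c;
  qop_distr : forall a b c, qop (qop a b) c = qop (qop a c) (qop b c)
}.

Definition left_translation (X : quandle) (a : X) : X -> X :=
  fun x => qop a x.

Definition latin (X : quandle) : Prop :=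
  forall a : X, bijective (left_translation a).

Definition mu (x : 'Z_3) : int := if x == 0 then 2 else -1.

Definition galkin_op (A : zmodType) (tau : 'Z_3 -> A) (p q : 'Z_3 * A) :
    'Z_3 * A :=
  let: (x, a) := p in
  let: (y, b) := q in
  (y *+ 2 - x, - a + b *~ mu (x - y) + tau (x - y)).

Lemma mu_opp d : mu (- d) = mu d.
Proof. by rewrite /mu oppr_eq0. Qed.

Lemma mu_distr d e : mu (e - d) + mu (d + e) = mu d * mu e.
Proof. by move: d e => [[|[|[|//]]] ?] [[|[|[|//]]] ?]. Qed.

Section GalkinQuandle.

Variables (A : zmodType) (tau : 'Z_3 -> A).
Hypothesis tau0 : tau 0 = 0.

Lemma tau_distr d e :
  tau (e - d) + tau (d + e) = tau e *~ mu d + tau d + tau (- d).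
Proof.
have Z3P (x : 'Z_3) : [\/ x = 0, x = 1 | x = -1].
  case: x => [[|[|[|//]]] ?].
  - by constructor 1; apply/val_inj.
  - by constructor 2; apply/val_inj.
  - by constructor 3; apply/val_inj.
have E2 : 1 + 1 = -1 :> 'Z_3 by apply/val_inj.
have E3 : -1 - 1 = 1 :> 'Z_3 by apply/val_inj.
have [->|->|->] := Z3P d.
- by rewrite /mu eqxx oppr0 tau0 !addr0 add0r.
- rewrite /mu /= mulrN1z.
  have [->|->|->] := Z3P e.
  + by rewrite sub0r addr0 tau0 oppr0 add0r addrC.
  + by rewrite subrr tau0 E2 add0r addNr add0r.
  + by rewrite E3 subrr tau0 addr0 addrAC addNr add0r.
- rewrite /mu /= mulrN1z opprK.
  have [->|->|->] := Z3P e.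
  + by rewrite addr0 add0r tau0 oppr0 add0r addrC.
  + by rewrite E2 addNr tau0 addr0 addrAC addNr add0r.
  + by rewrite addNr E3 tau0 add0r addNr add0r.
Qed.

Lemma galkin_nonempty : inhabited ('Z_3 * A).
Proof. by constructor; exact: (0, 0). Qed.

Lemma galkin_idem p : galkin_op tau p p = p.
Proof.
case: p => x a /=.
by rewrite subrr tau0 /mu eqxx addr0 mulr2n addrK -pmulrn mulr2n addKr.
Qed.

Lemma galkin_rdiv q r : exists! p, galkin_op tau p q = r.
Proof.
case: q r => y b [z c].
exists (y *+ 2 - z, b *~ mu (y - z) + tau (y - z) - c).
have E x : y *+ 2 - x - y = y - x by rewrite mulr2n addrAC addrK.
split => [|[x a]] /=.
  by rewrite E subKr opprB -addrA subrK.
case=> <- <-; rewrite subKr.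
have -> : y - (y *+ 2 - x) = x - y.
  by rewrite opprB addrCA mulr2n opprD addNKr.
by congr pair; rewrite -[- a + _ + _]addrA opprD opprK addrCA subrr addr0.
Qed.

Lemma galkin_distr p q r :
  galkin_op tau (galkin_op tau p q) r =
  galkin_op tau (galkin_op tau p r) (galkin_op tau q r).
Proof.
case: p q r => x a [y b] [z c] /=; congr pair.
  rewrite !mulrnBl !opprB; move: (z *+ 2) (y *+ 2) => w v.
  rewrite mulr2n -!addrA; congr (_ + _).
  by rewrite [RHS]addrC -!addrA addNr addr0 addrC.
have -> : y *+ 2 - x - z = (y - z) - (x - y).
  by rewrite opprB addrACA [- z - x]addrC addrA mulr2n.
have -> : z *+ 2 - x - (z *+ 2 - y) = - (x - y).
  by rewrite !opprB addrC addrA subrK.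
have -> : x - z = (x - y) + (y - z) by rewrite addrA subrK.
move: (x - y) (y - z) => d e.
have Emu : mu (e - d) = mu d * mu e - mu (d + e) by rewrite -mu_distr addrK.
have Etau : tau (e - d) = tau e *~ mu d + tau d + tau (- d) - tau (d + e).
  by rewrite -tau_distr addrK.
rewrite Emu Etau mu_opp mulrzBr mulrzDl mulrzDl mulNrz [mu d * _]mulrC mulrzA.
rewrite !opprD opprK.
rewrite [LHS](AC (3*2*4) ((1*5*9)*(2*4*6)*8*(3*7))) /=.
by rewrite addNr addr0.
Qed.

End GalkinQuandle.

Definition galkin_quandle (A : zmodType) (tau : 'Z_3 -> A)
    (tau0 : tau 0 = 0) : quandle :=
  Quandle (galkin_nonempty A) (galkin_idem tau0) (galkin_rdiv tau)
          (galkin_distr tau0).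

Arguments galkin_quandle : clear implicits.

(* Main.v *)
Require Import Defs.
From mathcomp Require Import all_boot all_order all_algebra.
From mathcomp Require Import all_fingroup all_solvable.

Import GRing.Theory FinRing.Theory.
Local Open Scope ring_scope.

(** The operation sends a fixed left factor (x, a) and a variable (y, b) to
    (2y - x, mu(x - y) b + const(y)).  Since 2 is invertible modulo 3, the first
    coordinate determines y, and on the fibre over y the map is affine in b with
    linear part mu(x - y), which is multiplication by -1 or by 2.  So the
    quandle is Latin exactly when doubling is injective on A: it suffices by
    finiteness, and it is necessary because (0, 0) * (0, b) = (0, 2b).  Finally,
    doubling is injective exactly when A has no element of order 2, that is
    (by Lagrange and Cauchy) when the order of A is odd. *)

(** Cauchy's theorem gives an element of order 2 in a group of even order; in
    odd order, b is killed both by 2 and, by Lagrange, by the odd number #|A|,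
    hence by 1. *)
Lemma double_eq0_oddP (A : finZmodType) :
  (forall b : A, b *+ 2 = 0 -> b = 0) <-> odd #|A|.
Proof.
split=> [no2tors | oddA b b2].
- apply/negPn/negP; rewrite -dvdn2 -cardsT => dvd2A.
  have [u _ ou] := Cauchy (G := [set: A]%G) (isT : prime 2) dvd2A.
  have u0 : u = 0 by apply: no2tors; rewrite -zmodXgE -ou expg_order.
  by move: ou; rewrite u0 -zmod1gE order1.
- have: b *+ #|A| = 0 by rewrite -zmodXgE -cardsT expg_cardG ?inE.
  by rewrite -(odd_double_half #|A|) oddA mulrnDr mulr1n -muln2 mulnC mulrnA b2
             mul0rn addr0.
Qed.

(** Doubling is an involution of Z_3, as 4 = 1 modulo 3. *)
Lemma double_Z3_inj : injective (fun y : 'Z_3 => y *+ 2).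
Proof.
move=> y y' /(congr1 (fun z => z *+ 2)).
have mul4 (z : 'Z_3) : z *+ 2 *+ 2 = z.
  by case: z => [[|[|[|//]]] ?]; apply/val_inj.
by rewrite !mul4.
Qed.

Theorem lemma5p1 (A : finZmodType) (tau : 'Z_3 -> A) (tau0 : tau 0 = 0) :
  latin (galkin_quandle A tau tau0) <-> odd #|A|.
Proof.
apply: iff_trans (double_eq0_oddP A); split=> [latX b b2 | no2tors [x a]].
- have /bij_inj injL := latX (0, 0).
  suff [] : ((0, b) : 'Z_3 * A) = (0, 0) by [].
  apply: injL; rewrite /left_translation /=.
  by rewrite subrr /mu eqxx -!pmulrn b2 !mul0rn.
- apply: (@injF_bij ('Z_3 * A)%type); case=> y b [y' b'].
  move=> eq_ab; have /addIr/double_Z3_inj eq_y := congr1 fst eq_ab.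
  move: (congr1 snd eq_ab); rewrite /= -eq_y => /addIr/addrI mu_bb'.
  congr pair; apply/eqP; rewrite -subr_eq0; apply/eqP.
  have: (b - b') *~ mu (x - y) = 0 by rewrite mulrzBl mu_bb' subrr.
  rewrite /mu; case: ifP => _; first by rewrite -pmulrn; apply: no2tors.
  by rewrite mulrN1z => /eqP; rewrite oppr_eq0 => /eqP.
Qed.
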